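(* For every double Stone algebra $\mathcal{DBS}=(DBS,\vee,\wedge,\sim,\neg,0,1)$ there exists a set $U$ such that $\mathcal{DBS}$ can be embedded into the double Stone algebra formed by $(\mathcal{P}(U))^{[3]}$.
   Context: A double Stone algebra is an algebra $(A,\vee,\wedge,\sim,\neg,0,1)$ such that $(A,\vee,\wedge,0,1)$ is a bounded distributive lattice; for every $a\in A$, $\sim a=\max\{c\in A:a\wedge c=0\}$ and $\neg a=\min\{c\in A:a\vee c=1\}$ exist; and $\sim a\vee\sim\sim a=1$, $\neg a\wedge\neg\neg a=0$ for all $a$. The one-element algebra is allowed. For a set $U$, $(\mathcal{P}(U))^{[3]}:=\{(A,B,C):A\subseteq B\subseteq C\subseteq U\}$ with componentwise union and intersection as $\vee,\wedge$, bottom $(\emptyset,\emptyset,\emptyset)$, top $(U,U,U)$, $\sim(A,B,C):=(C^{c},C^{c},C^{c})$ and $\neg(A,B,C):=(A^{c},A^{c},A^{c})$ (complements in $U$); this is a double Stone algebra. Embeddings preserve all operations, including $0$ and $1$. *)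

(* Defs.v *)
From HB Require Import structures.
From mathcomp Require Import all_boot all_order.
From mathcomp Require Import boolp classical_sets.

Set Implicit Arguments.
Unset Strict Implicit.
Unset Printing Implicit Defensive.

Import Order.Theory.

Local Open Scope order_scope.

(* [pcompl] is the operation written ~ and [dcompl] the one written ¬ in the
   usual signature of double Stone algebras. The first two axioms say that
   [pcompl a] is the maximum of {c | a /\ c = 0}, the next two that [dcompl a]
   is the minimum of {c | a \/ c = 1}. Bounded lattices are not required to
   satisfy 0 <> 1, so the one-element algebra is an instance. The choiceType
   structure included in bounded lattices is no restriction on the carrier,
   classically: see [gen_eqMixin] and [gen_choiceMixin]. *)
HB.mixin Record TBDistrLattice_isDblStone d T
    of Order.TBDistrLattice d T := {
  pcompl : T -> T;
  dcompl : T -> T;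
  meetx_pcompl : forall a : T, a `&` pcompl a = \bot;
  pcompl_max : forall a c : T, a `&` c = \bot -> c <= pcompl a;
  joinx_dcompl : forall a : T, a `|` dcompl a = \top;
  dcompl_min : forall a c : T, a `|` c = \top -> dcompl a <= c;
  pcompl_stone : forall a : T, pcompl a `|` pcompl (pcompl a) = \top;
  dcompl_stone : forall a : T, dcompl a `&` dcompl (dcompl a) = \bot
}.

#[short(type="dblStoneType")]
HB.structure Definition DblStone d :=
  { T of Order.TBDistrLattice d T & TBDistrLattice_isDblStone d T }.

Definition dblStone_embedding dA dB (A : dblStoneType dA)
    (B : dblStoneType dB) (f : A -> B) : Prop :=
  injective f /\
  {morph f : x y / x `|` y} /\
  {morph f : x y / x `&` y} /\
  {morph f : x / pcompl x} /\
  {morph f : x / dcompl x} /\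
  f \bot = \bot /\
  f \top = \top.

Local Open Scope classical_set_scope.

(* The elements of P(U)^[3]. *)
Record set3 (U : Type) := Set3 {
  lo : set U;
  mid : set U;
  hi : set U;
  lo_sub_mid : lo `<=` mid;
  mid_sub_hi : mid `<=` hi
}.

Lemma set3_eq U (X Y : set3 U) :
  lo X = lo Y -> mid X = mid Y -> hi X = hi Y -> X = Y.
Proof.
case: X Y => [A B C p q] [A' B' C' p' q'] /= eA eB eC.
by subst A' B' C'; congr Set3; exact: Prop_irrelevance.
Qed.

HB.instance Definition _ (U : Type) := gen_eqMixin (set3 U).
HB.instance Definition _ (U : Type) := gen_choiceMixin (set3 U).

Definition set3I U (X Y : set3 U) : set3 U :=
  @Set3 U (lo X `&` lo Y) (mid X `&` mid Y) (hi X `&` hi Y)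
    (setISS (@lo_sub_mid _ X) (@lo_sub_mid _ Y))
    (setISS (@mid_sub_hi _ X) (@mid_sub_hi _ Y)).

Definition set3U U (X Y : set3 U) : set3 U :=
  @Set3 U (lo X `|` lo Y) (mid X `|` mid Y) (hi X `|` hi Y)
    (setUSS (@lo_sub_mid _ X) (@lo_sub_mid _ Y))
    (setUSS (@mid_sub_hi _ X) (@mid_sub_hi _ Y)).

Definition set3_diag U (A : set U) : set3 U :=
  @Set3 U A A A (@subset_refl _ A) (@subset_refl _ A).

Definition set3_pcompl U (X : set3 U) : set3 U := set3_diag (~` hi X).

Definition set3_dcompl U (X : set3 U) : set3 U := set3_diag (~` lo X).

Definition set3_le U : rel (set3 U) := fun X Y => set3I X Y == X.

Definition set3_lt U : rel (set3 U) := fun X Y => (Y != X) && set3_le X Y.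

Fact set3_display : Order.disp_t. Proof. exact: Order.Disp tt tt. Qed.

Section Set3Lattice.
Variable U : Type.
Implicit Types X Y Z : set3 U.

Let leE X Y : set3_le X Y = (set3I X Y == X). Proof. by []. Qed.
Let ltE X Y : set3_lt X Y = (Y != X) && set3_le X Y. Proof. by []. Qed.
Let IC : commutative (@set3I U).
Proof. by move=> X Y; apply: set3_eq; exact: setIC. Qed.
Let UC : commutative (@set3U U).
Proof. by move=> X Y; apply: set3_eq; exact: setUC. Qed.
Let IA : associative (@set3I U).
Proof. by move=> X Y Z; apply: set3_eq; exact: setIA. Qed.
Let UA : associative (@set3U U).
Proof. by move=> X Y Z; apply: set3_eq; exact: setUA. Qed.
Let UKI Y X : set3I X (set3U X Y) = X.
Proof. by apply: set3_eq => /=; rewrite setUC setKU. Qed.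
Let IKU Y X : set3U X (set3I X Y) = X.
Proof. by apply: set3_eq => /=; rewrite setIC setKI. Qed.
Let IUl : left_distributive (@set3I U) (@set3U U).
Proof. by move=> X Y Z; apply: set3_eq; exact: setIUl. Qed.
Let Ixx : idempotent_op (@set3I U).
Proof. by move=> X; apply: set3_eq; exact: setIid. Qed.

HB.instance Definition _ := Order.isMeetJoinDistrLattice.Build
  set3_display (set3 U) leE ltE IC UC IA UA UKI IKU IUl Ixx.

Let le0 X : (set3_diag set0 <= X)%O.
Proof. by apply/eqP/set3_eq; exact: set0I. Qed.
Let le1 X : (X <= set3_diag setT)%O.
Proof. by apply/eqP/set3_eq; exact: setIT. Qed.

HB.instance Definition _ := Order.hasBottom.Build set3_display (set3 U) le0.
HB.instance Definition _ := Order.hasTop.Build set3_display (set3 U) le1.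

Let Ip X : (X `&` set3_pcompl X)%O = \bot%O.
Proof.
have mh := @mid_sub_hi _ X; have lh := subset_trans (@lo_sub_mid _ X) mh.
by apply: set3_eq => /=; rewrite -subset0 => u [Xu]; apply; auto.
Qed.

Let p_max X Y : (X `&` Y)%O = \bot%O -> (Y <= set3_pcompl X)%O.
Proof.
move=> XY; have hXY : hi X `&` hi Y = set0 by rewrite -[LHS]/(hi (X `&` Y)%O) XY.
have hY : hi Y `<=` ~` hi X by move=> u Yu Xu; rewrite -[False]/(set0 u) -hXY.
have mY := subset_trans (@mid_sub_hi _ Y) hY.
have lY := subset_trans (@lo_sub_mid _ Y) mY.
by apply/eqP/set3_eq; exact/setIidPl.
Qed.

Let Ud X : (X `|` set3_dcompl X)%O = \top%O.
Proof.
have ud A : lo X `<=` A -> A `|` ~` lo X = setT.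
  by move=> XA; rewrite -subTset -(setUCr (lo X)); exact: setSU.
apply: set3_eq; apply: ud => //; first exact: lo_sub_mid.
exact: subset_trans (@lo_sub_mid _ X) (@mid_sub_hi _ X).
Qed.

Let d_min X Y : (X `|` Y)%O = \top%O -> (set3_dcompl X <= Y)%O.
Proof.
move=> XY; have lXY : lo X `|` lo Y = setT by rewrite -[LHS]/(lo (X `|` Y)%O) XY.
have lY : ~` lo X `<=` lo Y.
  move=> u nXu; have : (lo X `|` lo Y) u by rewrite lXY.
  by case.
have mY := subset_trans lY (@lo_sub_mid _ Y).
have hY := subset_trans mY (@mid_sub_hi _ Y).
by apply/eqP/set3_eq; exact/setIidPl.
Qed.

Let p_stone X : (set3_pcompl X `|` set3_pcompl (set3_pcompl X))%O = \top%O.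
Proof. by apply: set3_eq => /=; rewrite setUCr. Qed.
Let d_stone X : (set3_dcompl X `&` set3_dcompl (set3_dcompl X))%O = \bot%O.
Proof. by apply: set3_eq => /=; rewrite setICr. Qed.

HB.instance Definition _ := TBDistrLattice_isDblStone.Build
  set3_display (set3 U) Ip p_max Ud d_min p_stone d_stone.

End Set3Lattice.

(* Main.v *)
(* Send [a] to the triple whose components are the sets of prime filters
   containing ¬¬a, a and ~~a. The middle component is Stone's representation of
   the lattice reduct, injective by the prime filter theorem. The outer ones are
   compatible with the lattice operations because ~~ and ¬¬ are endomorphisms of
   the bounded lattice, by the Stone identities. Every ~a and ¬a is complemented,
   hence fixed by both endomorphisms, and a prime filter contains exactly one
   element of a complementary pair. *)
Require Import Defs.
From HB Require Import structures.
From mathcomp Require Import all_boot all_order.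
From mathcomp Require Import boolp classical_sets.

Set Implicit Arguments.
Unset Strict Implicit.
Unset Printing Implicit Defensive.

Import Order.Theory.

Local Open Scope order_scope.

Definition prime_filter d (L : tbDistrLatticeType d) (F : set L) : Prop :=
  [/\ F \top, ~ F \bot,
      forall x y, F (x `&` y) <-> F x /\ F y &
      forall x y, F (x `|` y) <-> F x \/ F y].

Section PrimeFilterTheorem.
Variables (d : Order.disp_t) (L : tbDistrLatticeType d).
Implicit Types (x y a b : L) (F : set L).

(* The third condition allows the empty set, the union of the empty chain in
   Zorn's lemma; a nonempty [F] has to contain [a]. *)
Let separating a b F : Prop :=
  [/\ forall x y, x <= y -> F x -> F y,
      forall x y, F x -> F y -> F (x `&` y),
      forall x, F x -> F a & ~ F b].

(** Zorn's lemma gives a maximal filter containing [a] and omitting [b]; distributivity makes it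
    prime. *)
Lemma prime_filter_separation a b :
  ~~ (a <= b) -> exists F, [/\ prime_filter F, F a & ~ F b].
Proof.
move=> nab.
have [|F [[Fup FI Fa Fb] Fmax]] := @Zorn_bigcup L (separating a b).
  move=> C CP Ctot; split.
  - move=> x y xy [X CX Xx]; exists X => //.
    by case: (CP _ CX) => Xup _ _ _; exact: Xup Xx.
  - move=> x y [X CX Xx] [Y CY Yy].
    have [XY|YX] := Ctot _ _ CX CY.
      by exists Y => //; case: (CP _ CY) => _ YI _ _; apply: YI => //; exact: XY.
    by exists X => //; case: (CP _ CX) => _ XI _ _; apply: XI => //; exact: YX.
  - move=> x [X CX Xx]; exists X => //.
    by case: (CP _ CX) => _ _ Xa _; exact: Xa Xx.
  - by case=> X CX; case: (CP _ CX).
have Fmem G : separating a b G -> (F `<=` G)%classic -> (G `<=` F)%classic.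
  move=> sG FG; apply: contrapT => GF; exact: (Fmax G (conj FG GF) sG).
(* A maximal [F] without [a] would be empty, yet the principal filter of [a], which omits [b] by
   [nab], would be a larger separating set. *)
have {}Fa : F a.
  apply: contrapT => nFa; apply: (nFa).
  apply: (Fmem [set x | a <= x]%classic) => //=; last first.
    by move=> x Fx; case: nFa; exact: Fa Fx.
  split=> //=; last exact/negP.
  - by move=> x y xy ax; exact: le_trans xy.
  - by move=> x y ax ay; rewrite lexI ax ay.
(* For [x] outside [F], the filter generated by [F] and [x] contains [b], since otherwise maximality
   would put [x] into [F]. *)
have Fext x : ~ F x -> exists2 u, F u & u `&` x <= b.
  move=> nFx; apply: contrapT => nu; apply: nFx.
  apply: (Fmem [set z | exists2 u, F u & (u `&` x <= z)%O]%classic) => /=.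
  - split=> /=.
    + by move=> y z yz [u Fu uy]; exists u => //; exact: le_trans yz.
    + move=> y z [u Fu uy] [v Fv vz]; exists (u `&` v); first exact: FI.
      by rewrite lexI (le_trans _ uy) ?(le_trans _ vz) // leI2 // ?leIl ?leIr.
    + by move=> _ _; exists a => //; rewrite leIl.
    + exact: nu.
  - by move=> z Fz; exists z => //; rewrite leIl.
  - by exists a => //; rewrite leIr.
exists F; split=> //; split.
- exact: Fup Fa.
- by move=> F0; apply: Fb; exact: Fup F0.
- move=> x y; split=> [Fxy|[]]; last exact: FI.
  by split; apply: Fup Fxy; rewrite ?leIl ?leIr.
- move=> x y; split=> [Fxy|[]]; last 2 first.
  + by apply: Fup; rewrite leUl.
  + by apply: Fup; rewrite leUr.
  (* By distributivity, the meet of [u], [v] and the join of [x] and [y] lies below [b], which would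
     put [b] into [F]. *)
  apply: contrapT => /not_orP[/Fext[u Fu ux] /Fext[v Fv vy]]; apply: Fb.
  apply: Fup (FI _ _ (FI _ _ Fu Fv) Fxy).
  by rewrite meetUr leUx (le_trans _ ux) ?(le_trans _ vy) // leI2 // ?leIl ?leIr.
Qed.

End PrimeFilterTheorem.

(* On [A^d] the two complements are exchanged, so that the laws of [dcompl] are
   those of [pcompl] read in [A^d]. *)
HB.instance Definition _ d (A : dblStoneType d) :=
  TBDistrLattice_isDblStone.Build (Order.dual_display d) A^d
    (@joinx_dcompl _ A) (@dcompl_min _ A) (@meetx_pcompl _ A) (@pcompl_max _ A)
    (@dcompl_stone _ A) (@pcompl_stone _ A).

Section Pseudocomplement.
Variables (d : Order.disp_t) (A : dblStoneType d).
Implicit Types x y z : A.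

Lemma le_pcompl x y : (y <= pcompl x) = (x `&` y == \bot).
Proof.
apply/idP/eqP => [yx|]; last exact: pcompl_max.
by apply/eqP; rewrite -lex0 -(meetx_pcompl x) leI2.
Qed.

Lemma le_pcompl_pcompl x : x <= pcompl (pcompl x).
Proof. by rewrite le_pcompl meetC meetx_pcompl. Qed.

Lemma pcompl_anti x y : x <= y -> pcompl y <= pcompl x.
Proof. by move=> xy; rewrite le_pcompl -lex0 -(meetx_pcompl y) leI2. Qed.

Lemma pcomplK3 x : pcompl (pcompl (pcompl x)) = pcompl x.
Proof.
by apply/le_anti; rewrite le_pcompl_pcompl pcompl_anti ?le_pcompl_pcompl.
Qed.

Lemma pcompl0 : pcompl \bot = \top :> A.
Proof. by apply/le_anti; rewrite lex1 le_pcompl meet0x eqxx. Qed.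

Lemma pcompl1 : pcompl \top = \bot :> A.
Proof. by rewrite -[LHS]meet1x meetx_pcompl. Qed.

Lemma pcomplU x y : pcompl (x `|` y) = pcompl x `&` pcompl y.
Proof.
apply/le_anti; rewrite lexI !pcompl_anti ?leUl ?leUr //=.
rewrite le_pcompl meetUl meetA meetx_pcompl meet0x join0x.
by rewrite meetCA meetx_pcompl meetx0.
Qed.

(** Unlike the law for joins, this one rests on the Stone identity: ~(x ∧ y) is split along ~y ∨ ~~y
    = 1, and its part below ~~y is disjoint from x, hence below ~x. *)
Lemma pcomplI x y : pcompl (x `&` y) = pcompl x `|` pcompl y.
Proof.
apply/le_anti; rewrite leUx !pcompl_anti ?leIl ?leIr // !andbT.
set z := pcompl _.
have zxy : z `&` x <= pcompl y.
  by rewrite le_pcompl meetCA [y `&` x]meetC meetC meetx_pcompl.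
have zyx : z `&` pcompl (pcompl y) <= pcompl x.
  rewrite le_pcompl meetA [x `&` z]meetC -lex0 -(meetx_pcompl (pcompl y)).
  by rewrite leI2.
rewrite -[z]meetx1 -(pcompl_stone y) meetUr joinC.
by rewrite leU2 ?leIr.
Qed.

(** Distributivity gives ~x = ~x ∧ (x ∨ y) = ~x ∧ y. *)
Lemma pcompl_unique x y : x `&` y = \bot -> x `|` y = \top -> pcompl x = y.
Proof.
move=> xy0 xy1; apply/le_anti; rewrite pcompl_max // andbT.
by rewrite -[pcompl x]meetx1 -xy1 meetUr meetC meetx_pcompl join0x leIr.
Qed.

Lemma pcompl_dcompl x : pcompl (dcompl x) = dcompl (dcompl x).
Proof. by apply: pcompl_unique; [exact: dcompl_stone|exact: joinx_dcompl]. Qed.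

End Pseudocomplement.

Section DualPseudocomplement.
Variables (d : Order.disp_t) (A : dblStoneType d).
Implicit Types x y : A.

Lemma dcompl_dcompl_le x : dcompl (dcompl x) <= x.
Proof. exact: (@le_pcompl_pcompl _ A^d). Qed.

Lemma dcomplK3 x : dcompl (dcompl (dcompl x)) = dcompl x.
Proof. exact: (@pcomplK3 _ A^d). Qed.

Lemma dcompl0 : dcompl \bot = \top :> A.
Proof. exact: (@pcompl1 _ A^d). Qed.

Lemma dcompl1 : dcompl \top = \bot :> A.
Proof. exact: (@pcompl0 _ A^d). Qed.

Lemma dcomplU x y : dcompl (x `|` y) = dcompl x `&` dcompl y.
Proof. exact: (@pcomplI _ A^d). Qed.

Lemma dcomplI x y : dcompl (x `&` y) = dcompl x `|` dcompl y.
Proof. exact: (@pcomplU _ A^d). Qed.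

Lemma dcompl_pcompl x : dcompl (pcompl x) = pcompl (pcompl x).
Proof. exact: (@pcompl_dcompl _ A^d). Qed.

End DualPseudocomplement.

Section Representation.
Variables (d : Order.disp_t) (A : dblStoneType d).
Implicit Types x y : A.

(** The base set U. It is empty for the one-element algebra, and [set3] over it then has a single
    element too. *)
Definition prime_spectrum := {F : set A | prime_filter F}.

Definition spec_open x : set prime_spectrum := [set F | sval F x]%classic.

Lemma spec_open0 : spec_open \bot = set0.
Proof. by apply/seteqP; split=> // -[F []]. Qed.

Lemma spec_open1 : spec_open \top = setT.
Proof. by apply/seteqP; split=> // -[F []]. Qed.

Lemma spec_openI x y :
  spec_open (x `&` y) = (spec_open x `&` spec_open y)%classic.
Proof. by apply/seteqP; split=> -[F [? ? FI FU]] /FI. Qed.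

Lemma spec_openU x y :
  spec_open (x `|` y) = (spec_open x `|` spec_open y)%classic.
Proof. by apply/seteqP; split=> -[F [? ? FI FU]] /FU. Qed.

Lemma subset_spec_open x y : x <= y -> (spec_open x `<=` spec_open y)%classic.
Proof. by move=> /meet_l <-; rewrite spec_openI => F []. Qed.

(** Otherwise a prime filter containing [x] but not [y] would be a point of [spec_open x] outside
    [spec_open y]. *)
Lemma spec_open_le x y : (spec_open x `<=` spec_open y)%classic -> x <= y.
Proof.
move=> sxy; apply: contrapT => /negP /prime_filter_separation[F [pF Fx]].
by apply; exact: (sxy (exist _ F pF)).
Qed.

Lemma spec_open_inj : injective spec_open.
Proof. by move=> x y xy; apply/le_anti; rewrite !spec_open_le // xy. Qed.

Lemma spec_open_compl x y : x `&` y = \bot -> x `|` y = \top ->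
  spec_open y = (~` spec_open x)%classic.
Proof.
move=> xy0 xy1; apply/seteqP; split=> F Fy.
- by move=> Fx; rewrite -[False]/(set0 F) -spec_open0 -xy0 spec_openI.
- have : spec_open (x `|` y) F by rewrite xy1 spec_open1.
  by rewrite spec_openU => -[].
Qed.

(** The Stone identity makes ~x and ~~x complementary; the right-hand side is the complement of the
    top component of [spec_triple x]. *)
Lemma spec_open_pcompl x :
  spec_open (pcompl x) = (~` spec_open (pcompl (pcompl x)))%classic.
Proof.
apply: spec_open_compl; last by rewrite joinC pcompl_stone.
by rewrite meetC meetx_pcompl.
Qed.

Lemma spec_open_dcompl x :
  spec_open (dcompl x) = (~` spec_open (dcompl (dcompl x)))%classic.
Proof.
apply: spec_open_compl; first by rewrite meetC dcompl_stone.
by rewrite joinC joinx_dcompl.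
Qed.

Definition spec_triple x : set3 prime_spectrum :=
  Set3 (subset_spec_open (dcompl_dcompl_le x))
       (subset_spec_open (le_pcompl_pcompl x)).

Lemma spec_triple_embedding : dblStone_embedding spec_triple.
Proof.
split; first by move=> x y [_ /spec_open_inj].
split; first by move=> x y; apply: set3_eq; rewrite /= -spec_openU //
  ?(dcomplU, dcomplI) ?(pcomplU, pcomplI).
split; first by move=> x y; apply: set3_eq; rewrite /= -spec_openI //
  ?(dcomplU, dcomplI) ?(pcomplU, pcomplI).
(* [set3_pcompl] has three equal components, so ~~~x and ¬¬~x must both reduce to ~x; the case of ¬
   is dual. *)
split; first by move=> x; apply: set3_eq; rewrite /= -spec_open_pcompl //
  ?pcomplK3 // !dcompl_pcompl pcomplK3.
split; first by move=> x; apply: set3_eq; rewrite /= -spec_open_dcompl //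
  ?dcomplK3 // !pcompl_dcompl dcomplK3.
by split; apply: set3_eq;
  rewrite /= ?(pcompl0, pcompl1, dcompl0, dcompl1) ?(spec_open0, spec_open1).
Qed.

End Representation.

Theorem theorem14 (d : Order.disp_t) (A : dblStoneType d) :
  exists (U : Type) (f : A -> set3 U), dblStone_embedding f.
Proof.
by exists (prime_spectrum A), (@spec_triple d A); exact: spec_triple_embedding.
Qed.
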